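(* Let $X_Q=V(r^2-qs)\subset\mathbb{C}^4$ and for $d\in\mathbb{N}$ let $g_d:X_Q\to X_Q$ be the Chebyshev-induced morphism on $\mathbb{C}^3/D_4\simeq X_Q$. Let $C_A=V(-12+3p-q,\ r^2-qs,\ 108r+qr-54s,\ 108q+q^2-54r)\subset X_Q$ and let $G_{CA}:\mathbb{C}\to\mathbb{C}^4$, $G_{CA}(t)=(4+3t,\ 9t,\ 3t(6+t/2),\ t(6+t/2)^2)$. Then for every $d\in\mathbb{N}$: (1) $g_d(G_{CA}(t^2))=G_{CA}(T_d(t)^2)$ for all $t\in\mathbb{C}$; (2) $g_d(C_A)=C_A$.
   Context: $\mathbb{N}=\{1,2,\dots\}$. $T_d(z)$ is the one-variable Chebyshev polynomial with $T_d(s+s^{-1})=s^d+s^{-d}$. Definition of $g_d$: the Chebyshev endomorphism $P_{A_3}^d:\mathbb{C}^3\to\mathbb{C}^3$ is defined by $P_{A_3}^d(e_1(t),e_2(t),e_3(t))=(e_1(t^d),e_2(t^d),e_3(t^d))$ for $t=(t_1,t_2,t_3,t_4)\in(\mathbb{C}^* )^4$ with $t_1t_2t_3t_4=1$, where $t^d=(t_1^d,\dots,t_4^d)$ and $e_j$ is the $j$-th elementary symmetric polynomial. With $M_3(x,y,z)=(x+iy,\,z,\,x-iy)$ put $f_d=M_3^{-1}\circ P_{A_3}^d\circ M_3$. $D_4\subset GL(3,\mathbb{R})$ is the dihedral group of order 8 generated by $(x,y,z)\mapsto(-y,x,-z)$ and $(x,y,z)\mapsto(x,-y,z)$. The map $\tilde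 F(x,y,z)=(x^2+y^2,\,z^2,\,z(x^2-y^2),\,(x^2-y^2)^2)$ from $\mathbb{C}^3$ onto $X_Q$ (coordinates $(p,q,r,s)$) induces a bijection $\mathbb{C}^3/D_4\simeq X_Q$, and $g_d:X_Q\to X_Q$ is the unique map with $g_d\circ\tilde F=\tilde F\circ f_d$ (it is a morphism). *)

(* Defs.v *)
From mathcomp Require Import all_boot all_order all_algebra.
From mathcomp Require Import boolp classical_sets functions reals.
From mathcomp Require Import complex mpoly ring zify.

Set Implicit Arguments.
Unset Strict Implicit.
Unset Printing Implicit Defensive.

Import Order.TTheory GRing.Theory Num.Theory.
Local Open Scope classical_set_scope.
Local Open Scope ring_scope.

Notation C3 R := (R[i] * R[i] * R[i])%type.
Notation C4 R := (R[i] * R[i] * R[i] * R[i])%type.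

Section Definitions.
Variable R : realType.
Local Notation C := R[i].
Implicit Types (d : nat) (t : 4.-tuple C) (v w : C3 R).

(* Normalized by T_d(s + 1/s) = s^d + 1/s^d, see [chebE]; hence T_0 = 2. *)
Fixpoint cheb d : {poly C} :=
  match d with
  | 0 => 2%:P
  | 1 => 'X
  | (d''.+1 as d').+1 => 'X * cheb d' - cheb d''
  end.

Lemma chebE d (s : C) : s != 0 ->
  (cheb d).[s + s^-1] = s ^+ d + (s ^+ d)^-1.
Proof.
move=> s0; suff [] : (cheb d).[s + s^-1] = s ^+ d + (s ^+ d)^-1 /\
  (cheb d.+1).[s + s^-1] = s ^+ d.+1 + (s ^+ d.+1)^-1 by [].
elim: d => [|d [IH1 IH2]].
  by split; rewrite ?hornerC ?hornerX ?expr0 ?expr1 ?invr1.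
split=> //.
have -> : cheb d.+2 = 'X * cheb d.+1 - cheb d by [].
rewrite hornerD hornerN hornerM hornerX IH1 IH2.
rewrite !exprS; field.
by rewrite s0 expf_neq0.
Qed.

(* The condition t_1 t_2 t_3 t_4 = 1 already forces every t_i to be nonzero. *)
Definition torus : set (4.-tuple C) := [set t | \prod_(i < 4) tnth t i = 1].

Definition elem t : C3 R :=
  ((mesym 4 C 1).@[tnth t], (mesym 4 C 2).@[tnth t], (mesym 4 C 3).@[tnth t]).

Definition tpow d t : 4.-tuple C := [tuple tnth t i ^+ d | i < 4].

Lemma coef_prod_torus t k : torus t ->
  (\prod_(c <- t) ('X - c%:P))`_k = (k == 4%N)%:R - (elem t).1.1 *+ (k == 3%N)
    + (elem t).1.2 *+ (k == 2%N) - (elem t).2 *+ (k == 1%N) + (k == 0%N)%:R.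
Proof.
rewrite /torus /= => t1.
have sz : size (\prod_(c <- t) ('X - c%:P)) = 5%N.
  by rewrite size_prod_XsubC size_tuple.
have vieta (j : 'I_5) := mroots_coeff t j.
have s4 : (mesym 4 C 4).@[tnth t] = 1.
  rewrite mesymnnE rmorph_prod -[RHS]t1; apply: eq_bigr => i _.
  exact: mevalXU.
have s0 : (mesym 4 C 0).@[tnth t] = 1 by rewrite mesym0E meval1.
case: k => [|[|[|[|[|k]]]]] /=; last by rewrite nth_default ?sz //; ring.
- by have := vieta (inord 4); rewrite !inordK // subnn s4 => ->; ring.
- by have := vieta (inord 3); rewrite !inordK // => -> /=; ring.
- by have := vieta (inord 2); rewrite !inordK // => -> /=; ring.
- by have := vieta (inord 1); rewrite !inordK // => -> /=; ring.
- by have := vieta (inord 0); rewrite !inordK // s0 => -> /=; ring.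
Qed.

Lemma mesym_perm t t' k : (k < 5)%N -> perm_eq t t' ->
  (mesym 4 C k).@[tnth t] = (mesym 4 C k).@[tnth t'].
Proof.
move=> k5 tt'; have /= := mroots_coeff t (Ordinal k5).
rewrite (perm_big _ tt') (mroots_coeff t' (Ordinal k5)) /=.
by move/(mulfI _) => -> //; rewrite signr_eq0.
Qed.

Lemma elem_perm t t' : perm_eq t t' -> elem t = elem t'.
Proof. by move=> tt'; rewrite /elem !(mesym_perm _ tt'). Qed.

Lemma tpowE d t : tpow d t = map (fun z => z ^+ d) t :> seq C.
Proof.
have -> : tpow d t = map_tuple (fun z => z ^+ d) t.
  by apply: eq_from_tnth => i; rewrite tnth_mktuple tnth_map.
by [].
Qed.

Lemma elem_inj t t' : torus t -> torus t' -> elem t = elem t' -> perm_eq t t'.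
Proof.
move=> h h' e; apply: prod_XsubC_eq; apply/polyP => k.
by rewrite !coef_prod_torus // e.
Qed.

Lemma elem_surj v : exists t, torus t /\ elem t = v.
Proof.
case: v => [[a b] c].
pose p : {poly C} := 'X^4 + (- a *: 'X^3 + b *: 'X^2 - c *: 'X + 1).
have szl : (size (- a *: 'X^3 + b *: 'X^2 - c *: 'X + 1 : {poly C})%R
            < size ('X^4 : {poly C}))%N.
  rewrite size_polyXn ltnS; apply/leq_sizeP => j j4.
  rewrite !coefD !coefN !coefZ !coefXn coefX coef1.
  by case: j j4 => [|[|[|[|j]]]] //= _; ring.
have lcp : lead_coef p = 1 by rewrite /p lead_coefDl // lead_coefXn.
have szp : size p = 5%N by rewrite /p size_polyDl // size_polyXn.
have [r pr] := closed_field_poly_normal p.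
rewrite lcp scale1r in pr.
have szr : size r == 4%N.
  by move: szp; rewrite pr size_prod_XsubC => -[->].
pose t := Tuple szr.
have prt : p = \prod_(z <- t) ('X - z%:P) by [].
have vieta (j : 'I_5) := mroots_coeff t j.
have cf k : p`_k = (k == 4%N)%:R - a * (k == 3%N)%:R
     + b * (k == 2%N)%:R - c * (k == 1%N)%:R + (k == 0%N)%:R.
  by rewrite /p !coefD !coefN !coefZ !coefXn coefX coef1; ring.
have tT : torus t.
  have := vieta (inord 4); rewrite -prt cf !inordK //=.
  rewrite mesymnnE rmorph_prod /=.
  under eq_bigr do rewrite mevalXU.
  rewrite /torus /= => e.
  by move: e; rewrite -signr_odd /= expr0 mul1r => <-; ring.
exists t; split=> //.
have e k := coef_prod_torus k tT; rewrite -prt in e.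
have simp := (mulr0n, mulr1n, mulr0, mulr1, oppr0, addr0, add0r).
move: (e 1%N) (e 2%N) (e 3%N); rewrite !cf /= !simp.
by rewrite /elem => /oppr_inj <- <- /oppr_inj <-.
Qed.

(* [t] is any chosen point over [v]; the value does not depend on the choice,
   see [PA3_elem]. *)
Definition PA3 d v : C3 R := elem (tpow d (projT1 (cid (elem_surj v)))).

Lemma PA3_elem d t : torus t -> PA3 d (elem t) = elem (tpow d t).
Proof.
move=> tT; rewrite /PA3; case: cid => t' /= [t'T e].
by apply: elem_perm; rewrite !tpowE; apply/perm_map/elem_inj.
Qed.

Definition M3 v : C3 R := let: (x, y, z) := v in (x + 'i * y, z, x - 'i * y).

Definition M3inv v : C3 R :=
  let: (a, b, c) := v in ((a + c) / 2, (a - c) / (2 * 'i), b).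

Lemma i_neq0 : 'i != 0 :> C.
Proof. exact: neq0Ci. Qed.

Lemma M3K : cancel M3 M3inv.
Proof.
move=> [[x y] z]; rewrite /M3 /M3inv.
by congr (_, _, _); field; rewrite ?i_neq0.
Qed.

Lemma M3invK : cancel M3inv M3.
Proof.
move=> [[x y] z]; rewrite /M3 /M3inv.
by congr (_, _, _); field; rewrite ?i_neq0.
Qed.

Definition f_ d : C3 R -> C3 R := M3inv \o PA3 d \o M3.

Definition X_Q : set (C4 R) :=
  [set u | let: (p, q, r, s) := u in r ^+ 2 - q * s = 0].

Definition Fpoly v : C4 R :=
  let: (x, y, z) := v in
  (x ^+ 2 + y ^+ 2, z ^+ 2, z * (x ^+ 2 - y ^+ 2), (x ^+ 2 - y ^+ 2) ^+ 2).

Lemma Fpoly_X_Q v : X_Q (Fpoly v).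
Proof. by case: v => [[x y] z]; rewrite /X_Q /=; ring. Qed.

Definition Ftilde v : X_Q := SigSub (mem_set (Fpoly_X_Q v)).

Lemma Ftilde_surj (u : X_Q) : exists v, Ftilde v = u.
Proof.
case: u => -[[[p q] r] s] uX; have /= e := set_mem uX.
suff [v vE] : exists v, Fpoly v = (p, q, r, s) by exists v; apply: val_inj.
suff [z [D [zq Ds zD]]] : exists z D : C, [/\ z ^+ 2 = q, D ^+ 2 = s & z * D = r].
  exists (sqrtC ((p + D) / 2), sqrtC ((p - D) / 2), z) => /=.
  rewrite !sqrtCK -zq -Ds -zD.
  by congr (_, _, _, _); field.
have [q0|q0] := eqVneq q 0.
  exists 0, (sqrtC s); rewrite sqrtCK expr0n q0; split=> //.
  move: e; rewrite q0 mul0r subr0 => /eqP; rewrite sqrf_eq0 => /eqP ->.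
  by rewrite mul0r.
have z0 : sqrtC q != 0 by rewrite sqrtC_eq0.
exists (sqrtC q), (r / sqrtC q); rewrite sqrtCK; split=> //; last by field.
rewrite expr_div_n sqrtCK; move/eqP: e; rewrite subr_eq0 => /eqP ->.
by field.
Qed.

(* Defined by picking a point of the fibre of [Ftilde]; [g_Ftilde] and [g_unique]
   show that it is the unique map with g_d o Ftilde = Ftilde o f_d. *)
Definition g_ d (u : X_Q) : X_Q := Ftilde (f_ d (projT1 (cid (Ftilde_surj u)))).

(* The generators of D_4, and the orbit relation of the group they generate. *)
Definition rho v : C3 R := let: (x, y, z) := v in (- y, x, - z).
Definition sigma v : C3 R := let: (x, y, z) := v in (x, - y, z).

Inductive D4_orbit v : C3 R -> Prop :=
| D4_orbit_refl : D4_orbit v v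
| D4_orbit_rho w : D4_orbit v w -> D4_orbit v (rho w)
| D4_orbit_sigma w : D4_orbit v w -> D4_orbit v (sigma w).

Lemma Ftilde_D4 v w : Ftilde v = Ftilde w <-> D4_orbit v w.
Proof.
split=> [/(congr1 val)|]; last first.
  elim=> [//|{}w _ ->|{}w _ ->]; apply: val_inj; case: w => [[x y] z] /=.
    by congr (_, _, _, _); ring.
  by congr (_, _, _, _); ring.
case: v w => [[x y] z] [[x' y'] z'] /= -[e1 e2 e3 e4].
have orb := D4_orbit_refl (x, y, z).
have orb1 := D4_orbit_rho orb; have orb2 := D4_orbit_rho orb1.
have orb3 := D4_orbit_rho orb2.
have sorb := D4_orbit_sigma orb; have sorb1 := D4_orbit_sigma orb1.
have sorb2 := D4_orbit_sigma orb2; have sorb3 := D4_orbit_sigma orb3.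
rewrite /= ?opprK in orb orb1 orb2 orb3 sorb sorb1 sorb2 sorb3.
have two : 2 != 0 :> C by rewrite pnatr_eq0.
have alt : (z' = z /\ x' ^+ 2 - y' ^+ 2 = x ^+ 2 - y ^+ 2) \/
           (z' = - z /\ x' ^+ 2 - y' ^+ 2 = - (x ^+ 2 - y ^+ 2)).
  have [z0|z0] := eqVneq z 0.
    move: e2; rewrite z0 expr0n /= => /esym/eqP; rewrite sqrf_eq0 => /eqP ->.
    move/esym/eqP: e4; rewrite eqf_sqr => /orP[]/eqP ->; [left|right] => //.
    by rewrite oppr0.
  move/esym/eqP: (e2); rewrite eqf_sqr => /orP[]/eqP zz; [left|right].
    split=> //; apply: (mulfI z0).
    by rewrite e3 zz.
  split=> //; apply: (mulfI z0).
  by rewrite mulrN e3 zz mulNr opprK.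
have hX : x' ^+ 2 = ((x ^+ 2 + y ^+ 2) + (x' ^+ 2 - y' ^+ 2)) / 2.
  by rewrite e1; field.
have hY : y' ^+ 2 = ((x ^+ 2 + y ^+ 2) - (x' ^+ 2 - y' ^+ 2)) / 2.
  by rewrite e1; field.
case: alt => -[-> eD]; rewrite eD in hX hY.
  have /eqP : x' ^+ 2 = x ^+ 2 by rewrite hX; field.
  have /eqP : y' ^+ 2 = y ^+ 2 by rewrite hY; field.
  by rewrite !eqf_sqr => /orP[]/eqP -> /orP[]/eqP ->.
have /eqP : x' ^+ 2 = y ^+ 2 by rewrite hX; field.
have /eqP : y' ^+ 2 = x ^+ 2 by rewrite hY; field.
by rewrite !eqf_sqr => /orP[]/eqP -> /orP[]/eqP ->.
Qed.

(* On roots, [rho] is t |-> i t and [sigma] is t |-> 1/t. *)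
Lemma elem_scale (u : C) t : u ^+ 4 = 1 -> torus t ->
  let t' := [tuple u * tnth t i | i < 4] in
  torus t' /\ elem t' =
    (u * (elem t).1.1, u ^+ 2 * (elem t).1.2, u ^+ 3 * (elem t).2).
Proof.
move=> u4 tT t'; split.
  rewrite /torus /=; under eq_bigr do rewrite tnth_mktuple.
  by rewrite big_split /= tT prodr_const card_ord u4 mulr1.
have h k : (mesym 4 C k).@[tnth t'] = u ^+ k * (mesym 4 C k).@[tnth t].
  rewrite /mesym !rmorph_sum /= mulr_sumr; apply: eq_bigr => A /eqP Ak.
  rewrite !rmorph_prod /=; under eq_bigr do rewrite mevalXU tnth_mktuple.
  rewrite big_split /= prodr_const Ak; congr (_ * _).
  by apply: eq_bigr => i _; rewrite mevalXU.
by rewrite /elem !h expr1.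
Qed.

Lemma elem_inv t : torus t ->
  let t' := [tuple (tnth t i)^-1 | i < 4] in
  torus t' /\ elem t' = ((elem t).2, (elem t).1.2, (elem t).1.1).
Proof.
move=> tT t'; split.
  rewrite /torus /=; under eq_bigr do rewrite tnth_mktuple.
  by rewrite prodfV tT invr1.
have tn0 i : tnth t i != 0.
  have /prodf_neq0 : \prod_(i < 4) tnth t i != 0 by rewrite tT oner_neq0.
  exact.
have h k : (k <= 4)%N ->
    (mesym 4 C k).@[tnth t'] = (mesym 4 C (4 - k)).@[tnth t].
  move=> k4; rewrite /mesym !rmorph_sum /=.
  rewrite [RHS](reindex_inj (@finset.setC_inj _)) /=.
  have cA (A : {set 'I_4}) : (#|~: A| == 4 - k)%N = (#|A| == k).
    have := finset.cardsC A; rewrite card_ord => e.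
    by apply/eqP/eqP; lia.
  rewrite (eq_bigl _ _ cA); apply: eq_bigr => A _.
  rewrite !rmorph_prod /=; under eq_bigr do rewrite mevalXU tnth_mktuple.
  under [RHS]eq_bigr do rewrite mevalXU.
  rewrite prodfV; apply: (mulfI (x := \prod_(i in A) tnth t i)).
    by apply/prodf_neq0.
  rewrite divff; last by apply/prodf_neq0.
  rewrite -[LHS]tT (bigID (mem A)) /=; congr (_ * _).
  by apply: eq_bigl => i; rewrite inE.
by rewrite /elem !h.
Qed.

Lemma Fpoly_M3inv (a b c : C) : Fpoly (M3inv (a, b, c)) =
  (a * c, b ^+ 2, b * (a ^+ 2 + c ^+ 2) / 2, ((a ^+ 2 + c ^+ 2) / 2) ^+ 2).
Proof.
have ii : 'i ^+ 2 = -1 :> C := sqrCi _.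
have vv : 'i^-1 ^+ 2 = -1 :> C by rewrite exprVn ii invrN1.
rewrite /= !exprMn !invfM !exprMn vv.
by congr (_, _, _, _); field.
Qed.

Lemma torus_pow d t : torus t -> torus (tpow d t).
Proof.
move=> tT; rewrite /torus /=; under eq_bigr do rewrite tnth_mktuple.
by rewrite prodrXl tT expr1n.
Qed.

Lemma Ftilde_f_D4 d v w : D4_orbit v w -> Ftilde (f_ d v) = Ftilde (f_ d w).
Proof.
have ii : 'i ^+ 2 = -1 :> C := sqrCi _.
have i4 : 'i ^+ 4 = 1 :> C by rewrite -[4%N]/(2 * 2)%N exprM ii sqrrN expr1n.
elim=> [//|{}w _ ->|{}w _ ->]; apply: val_inj.
  change (Fpoly (M3inv (PA3 d (M3 w))) = Fpoly (M3inv (PA3 d (M3 (rho w))))).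
  have [t [tT tE]] := elem_surj (M3 w).
  have [iT iE] := elem_scale i4 tT.
  have u4 : ('i ^+ d) ^+ 4 = 1 :> C by rewrite exprAC i4 expr1n.
  have [_ dE] := elem_scale u4 (torus_pow d tT).
  have -> : M3 (rho w) = elem [tuple 'i * tnth t i | i < 4].
    rewrite iE tE; case: w {tE} => [[x y] z] /=.
    by congr (_, _, _); ring: ii.
  rewrite -tE !PA3_elem //.
  have -> : tpow d [tuple 'i * tnth t i | i < 4] =
            [tuple 'i ^+ d * tnth (tpow d t) i | i < 4].
    by apply: eq_from_tnth => i; rewrite !tnth_mktuple exprMn.
  rewrite dE; case: (elem (tpow d t)) => [[a b] c].
  rewrite !Fpoly_M3inv /=; set u := 'i ^+ d in u4 *.
  by congr (_, _, _, _); ring: u4.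
change (Fpoly (M3inv (PA3 d (M3 w))) = Fpoly (M3inv (PA3 d (M3 (sigma w))))).
have [t [tT tE]] := elem_surj (M3 w).
have [iT iE] := elem_inv tT.
have [_ dE] := elem_inv (torus_pow d tT).
have -> : M3 (sigma w) = elem [tuple (tnth t i)^-1 | i < 4].
  rewrite iE tE; case: w {tE} => [[x y] z] /=.
  by congr (_, _, _); ring.
rewrite -tE !PA3_elem //.
have -> : tpow d [tuple (tnth t i)^-1 | i < 4] =
          [tuple (tnth (tpow d t) i)^-1 | i < 4].
  by apply: eq_from_tnth => i; rewrite !tnth_mktuple exprVn.
rewrite dE; case: (elem (tpow d t)) => [[a b] c].
by rewrite !Fpoly_M3inv /=; congr (_, _, _, _); ring.
Qed.

Lemma g_Ftilde d v : g_ d (Ftilde v) = Ftilde (f_ d v).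
Proof.
rewrite /g_; case: cid => w /= /Ftilde_D4 wv.
exact: Ftilde_f_D4.
Qed.

Lemma g_unique d (h : X_Q -> X_Q) :
  (forall v, h (Ftilde v) = Ftilde (f_ d v)) -> h = g_ d.
Proof.
move=> hF; apply: funext => u; have [v <-] := Ftilde_surj u.
by rewrite hF g_Ftilde.
Qed.

Definition C_A : set (C4 R) := [set u | let: (p, q, r, s) := u in
  [/\ -12 + 3 * p - q = 0,
      r ^+ 2 - q * s = 0,
      108 * r + q * r - 54 * s = 0 &
      108 * q + q ^+ 2 - 54 * r = 0]].

Definition G_CA (t : C) : C4 R :=
  (4 + 3 * t, 9 * t, 3 * t * (6 + t / 2), t * (6 + t / 2) ^+ 2).

Lemma G_CA_X_Q (t : C) : X_Q (G_CA t).
Proof. by rewrite /X_Q /=; ring. Qed.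

(* [G_CA] corestricted to [X_Q], so that [g_ d] applies to its values. *)
Definition G_CA_in_X_Q (t : C) : X_Q := SigSub (mem_set (G_CA_X_Q t)).

End Definitions.

Arguments cheb : clear implicits.
Arguments X_Q : clear implicits.
Arguments C_A : clear implicits.
Arguments torus : clear implicits.

(* Main.v *)
Require Import Defs.
From mathcomp Require Import all_boot all_order all_algebra.
From mathcomp Require Import boolp classical_sets functions reals.
From mathcomp Require Import complex.
From mathcomp Require Import ring.

Import GRing.Theory Num.Theory.
Local Open Scope classical_set_scope.
Local Open Scope ring_scope.

(* The curve comes from the torus points (w, w, w, w^-3), a family stable under
   t |-> t^d: its image under F~ o M_3^-1 o (e_1, e_2, e_3) is
   G_CA (T ^ 2) with T = w^2 + w^-2, so g_d acts on it by w |-> w^d, i.e.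
   T |-> T_d(T). Part (2) follows since the equations of C_A are solved by G_CA
   and T_d is surjective for d > 0. *)

(** The witnesses [s] and [s'] are the two roots of [X^2 - t X + 1], whose product is 1. *)
Lemma addV_surj (F : numClosedFieldType) (t : F) :
  exists2 s : F, s != 0 & t = s + s^-1.
Proof.
pose s := (t + sqrtC (t ^+ 2 - 4)) / 2.
pose s' := (t - sqrtC (t ^+ 2 - 4)) / 2.
have ss' : s * s' = 1.
  have -> : s * s' = (t ^+ 2 - sqrtC (t ^+ 2 - 4) ^+ 2) / 4.
    by rewrite /s /s'; field.
  by rewrite sqrtCK; field.
have s0 : s != 0 by apply: contra_eq_neq ss' => ->; rewrite mul0r eq_sym oner_eq0.
exists s => //; have -> : s^-1 = s' by apply: (mulfI s0); rewrite ss' divff.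
by rewrite /s /s'; field.
Qed.

Section TripleRoot.
Set Implicit Arguments.
Unset Strict Implicit.
Variable R : realType.
Local Notation C := R[i].

Definition triple (w : C) : 4.-tuple C := [tuple w; w; w; w ^- 3].

Lemma torus_triple (w : C) : w != 0 -> torus R (triple w).
Proof.
move=> w0; rewrite /torus /= !big_ord_recl big_ord0 !(tnth_nth 0) /=.
by field.
Qed.

Lemma tpow_triple d (w : C) : tpow d (triple w) = triple (w ^+ d).
Proof.
apply: val_inj; rewrite [LHS]tpowE /=.
by rewrite exprVn exprAC.
Qed.

Lemma elem_triple (w : C) : w != 0 ->
  elem (triple w) = (3 * w + w ^- 3, 3 * (w ^+ 2 + w ^- 2), w ^+ 3 + 3 * w^-1).
Proof.
move=> w0; have e k := coef_prod_torus k (torus_triple w0).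
have prodE : \prod_(c <- triple w) ('X - c%:P) =
    'X^4 - (3 * w + w ^- 3) *: 'X^3 + (3 * (w ^+ 2 + w ^- 2)) *: 'X^2
    - (w ^+ 3 + 3 * w^-1) *: 'X + 1 :> {poly C}.
  (* [ring] treats [w] and its inverse as independent atoms tied by this relation. *)
  have WV : w%:P * w^-1%:P = 1 :> {poly C} by rewrite -polyCM divff.
  rewrite !big_cons big_nil -!mul_polyC -!exprVn.
  rewrite !(polyC_natr, polyCD, polyCM, polyC_exp).
  move: (w%:P) (w^-1%:P) WV => W V WV.
  by ring: WV.
have simp := (mulr0n, mulr1n, mulr0, mulr1, oppr0, addr0, add0r).
move: (e 1%N) (e 2%N) (e 3%N); rewrite prodE.
rewrite !(coefD, coefN, coefZ, coefXn, coefX, coef1) /= !simp.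
by rewrite /elem => /oppr_inj <- <- /oppr_inj <-.
Qed.

Lemma Fpoly_triple (w : C) : w != 0 ->
  Fpoly (M3inv (elem (triple w))) = G_CA ((w ^+ 2 + w ^- 2) ^+ 2).
Proof.
move=> w0; rewrite elem_triple // Fpoly_M3inv /G_CA.
by congr (_, _, _, _); field.
Qed.

(** Lifting the point through [Ftilde] to [M3inv (elem (triple w))] makes [M3] cancel, and [PA3]
    then only raises [w] to the power [d]. *)
Lemma g_triple d (w : C) : w != 0 ->
  val (g_ d (G_CA_in_X_Q ((w ^+ 2 + w ^- 2) ^+ 2))) =
  G_CA (((w ^+ d) ^+ 2 + (w ^+ d) ^- 2) ^+ 2).
Proof.
move=> w0.
have -> : G_CA_in_X_Q ((w ^+ 2 + w ^- 2) ^+ 2) = Ftilde (M3inv (elem (triple w))).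
  by apply: val_inj; rewrite /= -Fpoly_triple.
rewrite g_Ftilde -Fpoly_triple ?expf_neq0 // -tpow_triple.
rewrite -[LHS]/(Fpoly (M3inv (PA3 d (M3 (M3inv (elem (triple w))))))).
by rewrite M3invK PA3_elem //; apply: torus_triple.
Qed.

Lemma g_G_CA d (t : C) :
  val (g_ d (G_CA_in_X_Q (t ^+ 2))) = G_CA ((cheb R d).[t] ^+ 2).
Proof.
have [s s0 ->] := addV_surj _ t.
(* With [w = sqrtC s], the parameter [t = s + s^-1] becomes [w ^+ 2 + w ^- 2]. *)
have w0 : sqrtC s != 0 by rewrite sqrtC_eq0.
rewrite chebE // -[s]sqrtCK g_triple //.
by rewrite ![_ ^+ 2 ^+ d]exprAC.
Qed.

(** If [y = s + s^-1], a [d]-th root of [s] plus its inverse maps to [y]; for [d = 0] the polynomial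
    is constant. *)
Lemma cheb_surj d (y : C) : (0 < d)%N -> exists x, (cheb R d).[x] = y.
Proof.
move=> d0; have [s s0 ->] := addV_surj _ y.
have x0 : d.-root s != 0 by rewrite rootC_eq0.
by exists (d.-root s + (d.-root s)^-1); rewrite chebE // rootCK.
Qed.

Lemma C_A_G_CA (t : C) : C_A R (G_CA t).
Proof. by split; field. Qed.

(** The equations express [p] and [r], then [s], through [q], and [q = 9 * t ^+ 2] fixes [t] up to
    sign. *)
Lemma G_CA_surj (u : C4 R) : C_A R u -> exists t, G_CA (t ^+ 2) = u.
Proof.
case: u => [[[p q] r] s] [e1 _ e3 e4]; exists (sqrtC (q / 9)).
have pE : p = 4 + q / 3.
  (* The difference of the two sides is the defining equation divided by 3; below, by 54. *)
  by apply/eqP; rewrite -subr_eq0 -(mul0r 3^-1) -e1; apply/eqP; field.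
have rE : r = (108 * q + q ^+ 2) / 54.
  by apply/esym/eqP; rewrite -subr_eq0 -(mul0r 54^-1) -e4; apply/eqP; field.
have sE : s = (108 * r + q * r) / 54.
  by apply/esym/eqP; rewrite -subr_eq0 -(mul0r 54^-1) -e3; apply/eqP; field.
by rewrite sqrtCK /G_CA sE rE pE; congr (_, _, _, _); field.
Qed.

End TripleRoot.

Theorem proposition4p26 (R : realType) (d : nat) (hd : (0 < d)%N) :
  (forall t : R[i],
      val (g_ d (G_CA_in_X_Q (t ^+ 2))) = G_CA ((cheb R d).[t] ^+ 2)) /\
  [set val (g_ d u) | u in [set u : X_Q R | C_A R (val u)]] = C_A R.
Proof.
split; first exact: g_G_CA.
apply/seteqP; split=> [_ [u /= uA <-]|v /G_CA_surj [y <-]].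
  have [t tu] := G_CA_surj uA.
  have -> : u = G_CA_in_X_Q (t ^+ 2) by apply: val_inj.
  by move: (C_A_G_CA ((cheb R d).[t] ^+ 2)); rewrite -g_G_CA.
(* A preimage of [G_CA (y ^+ 2)] comes from a preimage of [y] under the Chebyshev polynomial. *)
have [x <-] := cheb_surj y hd.
exists (G_CA_in_X_Q (x ^+ 2)); last exact: g_G_CA.
exact: C_A_G_CA.
Qed.
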